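(* Let $\mathbb{F}$ be a field and $n\geq 1$ an integer. Let $\mathcal{A}_1,\mathcal{A}_2,\mathcal{A}_3,\mathcal{A}_4$ be subsets of $\mathrm{GL}_n(\mathbb{F})$, in which each $\mathcal{A}_i$ equals the set of all involutions of $\mathrm{GL}_n(\mathbb{F})$ or the set of all $U_2$-matrices of $\mathrm{GL}_n(\mathbb{F})$. If at least one $\mathcal{A}_i$ equals the set of all involutions, then $$\mathcal{A}_1\mathcal{A}_2\mathcal{A}_3\mathcal{A}_4=\{M\in\mathrm{GL}_n(\mathbb{F}) : \det M=\pm 1\}.$$ Otherwise, $$\mathcal{A}_1\mathcal{A}_2\mathcal{A}_3\mathcal{A}_4=\mathrm{SL}_n(\mathbb{F}).$$
   Context: A matrix $A\in\mathrm{GL}_n(\mathbb{F})$ is an involution if $A^2=I_n$, and a $U_2$-matrix (unipotent of index $2$) if $(A-I_n)^2=0$; $I_n$ is both. For subsets $\mathcal{A}_1,\dots,\mathcal{A}_k$ of $\mathrm{GL}_n(\mathbb{F})$, $\mathcal{A}_1\cdots\mathcal{A}_k:=\{S_1S_2\cdots S_k \mid S_1\in\mathcal{A}_1,\dots,S_k\in\mathcal{A}_k\}$. $\mathrm{SL}_n(\mathbb{F})$ is the group of $n\times n$ matrices with determinant $1$. *)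

(* Defs.v *)
From mathcomp Require Import all_boot all_order all_algebra.
From mathcomp Require Import classical_sets.

Set Implicit Arguments.
Unset Strict Implicit.
Unset Printing Implicit Defensive.

Import GRing.Theory.
Local Open Scope classical_set_scope.
Local Open Scope ring_scope.

Definition GLset (F : fieldType) (n : nat) : set 'M[F]_n :=
  [set M : 'M[F]_n | M \in unitmx].
Arguments GLset : clear implicits.

Definition SLset (F : fieldType) (n : nat) : set 'M[F]_n :=
  [set M : 'M[F]_n | \det M = 1].
Arguments SLset : clear implicits.

Definition involutions (F : fieldType) (n : nat) : set 'M[F]_n :=
  [set A : 'M[F]_n | GLset F n A /\ A ^+ 2 = 1%:M].
Arguments involutions : clear implicits.

Definition U2_matrices (F : fieldType) (n : nat) : set 'M[F]_n :=
  [set A : 'M[F]_n | GLset F n A /\ (A - 1%:M) ^+ 2 = 0].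
Arguments U2_matrices : clear implicits.

Definition setprod (F : fieldType) (n k : nat) (A : 'I_k -> set 'M[F]_n) :
    set 'M[F]_n :=
  [set M : 'M[F]_n | exists2 S : 'I_k -> 'M[F]_n,
     (forall i, A i (S i)) & M = \prod_(i < k) S i].

(* Main.v *)
Require Import Defs.
From mathcomp Require Import all_boot all_order all_algebra.
From mathcomp Require Import classical_sets boolp.
From mathcomp Require Import ring zify.

Set Implicit Arguments.
Unset Strict Implicit.
Unset Printing Implicit Defensive.

Import GRing.Theory.
Local Open Scope classical_set_scope.
Local Open Scope ring_scope.

(** Both kinds of matrices are roots of a quadratic polynomial: [A] is an
    involution when (A - 1)(A + 1) = 0 and a U2-matrix when (A - 1)(A - 1) = 0.
    Say that [A] has type [r], for a sign [r], when (A - 1)(A - r) = 0.  The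
    matrices of a given type are stable under conjugation, and
    S T = (S T S^-1) S, so that the order of the four types is irrelevant
    ([prod_of_perm]).  Two of the four types agree; let [s] be their common
    value and [rS], [rT] the other two, with [rT = -1] as soon as an involution
    occurs at all.  Given [M] of determinant 1 or -1, the task is to find
    matrices [X] and [Y] with [M] similar to Y X, where [X] is a product of
    matrices of types [rS] and [rT], and [Y] of two matrices of type [s].

    A cyclic matrix is determined up to similarity by its characteristic
    polynomial ([cyclic_similar]), so it suffices to control that polynomial.
    Let al = rS rT.  A block triangular construction produces cyclic products
    S T whose characteristic polynomial is any product of quadratic factors
    x^2 - t x + al, times at most two linear factors x - 1 (or x + 1, if an
    involution is available): see [realizable_quads], [realizable_top_prod].

    To factor [M], decompose it into companion blocks C_1, ..., C_k
    ([cyclic_split]).  A companion matrix C_i factors as Y_i X_i, where X_i is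
    the companion matrix of any polynomial p_i of the same degree with
    p_i(0) != 0, and Y_i differs from the identity in its last row only, its
    last diagonal entry being y_i = det C_i / det X_i.  One entry linking each X_i
    to the next makes the direct sum X of the X_i cyclic, with characteristic
    polynomial the product of the p_i; the compensating entries in Y make Y
    cyclic modulo its fixed vectors, with characteristic polynomial
    (x - 1)^(n - k) times the product of the x - y_i ([compan_step]).

    All that remains is to choose the p_i.  Each has one adjustable root x_i,
    its other roots being 1 or al.  Since x_i y_i is prescribed up to the choice
    of these other roots, one can alternate: x_1 is a sign, y_1 y_2 = 1,
    x_2 x_3 = al, y_3 y_4 = 1, and so on ([block_induction]).  Then all
    roots group into quadratic factors x^2 - t x + 1 for Y and x^2 - t x + al
    for X, except x_1, possibly one root 1, and possibly the very last root;
    the determinant makes the latter harmless, provided that the sign x_1 is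
    chosen according to det M and n ([prod_of_canonical_four]).  This
    works over every field, for scalar matrices as well as for the others. *)

(** * Similarity and products of quadratic matrices *)
Section Products.
Variable F : fieldType.

(** The type [r] is -1 for involutions and 1 for U2-matrices; in characteristic
    2 both types coincide, as they should. *)
Definition quad_mx (r : F) n (A : 'M[F]_n) : Prop :=
  (A - 1%:M) *m (A - r%:M) = 0.

Lemma quad_mxE r n (A : 'M[F]_n) :
  quad_mx r A <-> A *m A = (1 + r) *: A - r%:M.
Proof.
have -> : quad_mx r A <-> A *m A - ((1 + r) *: A - r%:M) = 0.
  rewrite /quad_mx mulmxBl !mulmxBr mul1mx mul_mx_scalar -scalar_mxM mul1r.
  suff -> : A *m A - r *: A - (A - r%:M) = A *m A - ((1 + r) *: A - r%:M) by [].
  rewrite scalerDl scale1r !opprB !opprD addrA.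
  by apply/matrixP=> i j; rewrite !mxE; ring.
by split=> [/eqP|->]; rewrite ?subrr ?subr_eq0 // => /eqP.
Qed.

(** The two sizes are kept independent, although they end up equal, so that
    block decompositions need no casts. *)
Definition similar_mx m n (A : 'M[F]_m) (B : 'M[F]_n) : Prop :=
  exists P : 'M[F]_(m, n), exists Q : 'M[F]_(n, m),
    [/\ P *m Q = 1%:M, Q *m P = 1%:M & A *m P = P *m B].

Lemma similar_refl n (A : 'M[F]_n) : similar_mx A A.
Proof. by exists 1%:M, 1%:M; rewrite !mulmx1 mul1mx. Qed.

Lemma similar_sym m n (A : 'M[F]_m) (B : 'M[F]_n) : similar_mx A B -> similar_mx B A.
Proof.
case=> P [Q [PQ QP AP]]; exists Q, P; split=> //.
by rewrite -[B *m Q]mul1mx -QP -mulmxA (mulmxA P) -AP -mulmxA PQ mulmx1.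
Qed.

Lemma similar_trans m n p (A : 'M[F]_m) (B : 'M[F]_n) (C : 'M[F]_p) :
  similar_mx A B -> similar_mx B C -> similar_mx A C.
Proof.
case=> P [Q [PQ QP AP]] [R [S [RS SR BR]]]; exists (P *m R), (S *m Q).
split; first by rewrite -mulmxA (mulmxA R) RS mul1mx.
  by rewrite -mulmxA (mulmxA Q) QP mul1mx.
by rewrite mulmxA AP -mulmxA BR mulmxA.
Qed.

Lemma similar_mxE m n (A : 'M[F]_m) (B : 'M[F]_n) P Q :
  P *m Q = 1%:M -> A *m P = P *m B -> A = P *m B *m Q.
Proof. by move=> PQ <-; rewrite -mulmxA PQ mulmx1. Qed.

Lemma similar_dim m n (A : 'M[F]_m) (B : 'M[F]_n) : similar_mx A B -> m = n.
Proof.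
case=> P [Q [PQ QP _]]; apply/eqP; rewrite eqn_leq.
have h k l (R : 'M[F]_(k, l)) (S : 'M[F]_(l, k)) : R *m S = 1%:M -> (k <= l)%N.
  by move=> RS; rewrite -[k](mxrank1 F) -RS (leq_trans (mxrankM_maxl _ _)) ?rank_leq_col.
by rewrite (h _ _ _ _ PQ) (h _ _ _ _ QP).
Qed.

Lemma similar_char_poly m n (A : 'M[F]_m) (B : 'M[F]_n) :
  similar_mx A B -> char_poly A = char_poly B.
Proof.
move=> AB; have e := similar_dim AB; subst n.
case: AB => P [Q [PQ QP AP]].
have detPQ : \det (map_mx polyC P) * \det (map_mx polyC Q) = 1.
  by rewrite -det_mulmx -map_mxM PQ map_mx1 det1.
rewrite /char_poly.
have -> : char_poly_mx A = map_mx polyC P *m char_poly_mx B *m map_mx polyC Q.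
  rewrite /char_poly_mx mulmxBr mulmxBl mul_mx_scalar -scalemxAl -!map_mxM.
  by rewrite PQ map_mx1 scalemx1 -(similar_mxE PQ AP).
by rewrite !det_mulmx mulrAC detPQ mul1r.
Qed.

Lemma similar_det m n (A : 'M[F]_m) (B : 'M[F]_n) : similar_mx A B -> \det A = \det B.
Proof.
move=> AB; have e := similar_dim AB; subst n.
case: AB => P [Q [PQ QP AP]]; rewrite (similar_mxE PQ AP) !det_mulmx mulrAC -det_mulmx.
by rewrite PQ det1 mul1r.
Qed.

Lemma quad_mx_conj r m n (P : 'M[F]_(m, n)) Q (B : 'M[F]_n) :
  P *m Q = 1%:M -> Q *m P = 1%:M -> quad_mx r B -> quad_mx r (P *m B *m Q).
Proof.
move=> PQ QP hB; rewrite /quad_mx.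
have sc c : P *m B *m Q - c%:M = P *m (B - c%:M) *m Q.
  by rewrite mulmxBr mulmxBl mul_mx_scalar -scalemxAl PQ scalemx1.
by rewrite !sc -mulmxA !(mulmxA Q) QP mul1mx mulmxA -(mulmxA P) hB mulmx0 mul0mx.
Qed.

Lemma quad_mx_unit r n (A : 'M[F]_n) : r != 0 -> quad_mx r A -> A \in unitmx.
Proof.
move=> r0 /quad_mxE hA.
have : (A *m (r^-1 *: ((1 + r)%:M - A))) = 1%:M.
  rewrite -scalemxAr mulmxBr mul_mx_scalar hA opprB addrC subrK.
  by rewrite scale_scalar_mx mulVf.
by case/mulmx1_unit.
Qed.

Fixpoint prod_of (s : seq F) n (M : 'M[F]_n) : Prop :=
  if s is r :: s' then
    exists A, exists B, [/\ quad_mx r A, prod_of s' B & M = A *m B]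
  else M = 1%:M.

Lemma prod_of_conj s m n (P : 'M[F]_(m, n)) Q (B : 'M[F]_n) :
  P *m Q = 1%:M -> Q *m P = 1%:M -> prod_of s B -> prod_of s (P *m B *m Q).
Proof.
move=> PQ QP; elim: s B => [|r s IH] B /=; first by move->; rewrite mulmx1.
case=> A [C [hA hC ->]]; exists (P *m A *m Q), (P *m C *m Q).
split; [exact: quad_mx_conj | exact: IH |].
by rewrite !mulmxA -(mulmxA (P *m A) Q P) QP mulmx1.
Qed.

Lemma prod_of_similar s m n (A : 'M[F]_m) (B : 'M[F]_n) :
  similar_mx A B -> prod_of s B -> prod_of s A.
Proof.
by case=> P [Q [PQ QP AP]] hB; rewrite (similar_mxE PQ AP); apply: prod_of_conj.
Qed.

Lemma prod_of_cat s t n (M : 'M[F]_n) :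
  prod_of (s ++ t) M <->
  exists A, exists B, [/\ prod_of s A, prod_of t B & M = A *m B].
Proof.
elim: s M => [|r s IH] M /=.
  split=> [h|[A [B [-> h ->]]]]; last by rewrite mul1mx.
  by exists 1%:M, M; rewrite mul1mx.
split=> [[A [B [hA /IH[C [D [hC hD ->]]] ->]]]|].
  by exists (A *m C), D; split=> //; [exists A, C | rewrite mulmxA].
case=> _ [D [[A [C [hA hC ->]]] hD ->]]; exists A, (C *m D); split=> //.
  by apply/IH; exists C, D.
by rewrite mulmxA.
Qed.

Lemma prod_of_unit s n (M : 'M[F]_n) :
  all (fun r => r != 0) s -> prod_of s M -> M \in unitmx.
Proof.
elim: s M => [|r s IH] M /=; first by move=> _ ->; rewrite unitmx1.
case/andP=> r0 hs [A [B [hA hB ->]]].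
by rewrite unitmx_mul (quad_mx_unit r0 hA) IH.
Qed.

(** A product of [s]-matrices conjugates a product of [t]-matrices into
    another one, so that A B = (A B A^-1) A. *)
Lemma prod_of_catC s t n (M : 'M[F]_n) : all (fun r => r != 0) s ->
  prod_of (s ++ t) M -> prod_of (t ++ s) M.
Proof.
move=> hs /prod_of_cat[A [B [hA hB ->]]]; have uA := prod_of_unit hs hA.
apply/prod_of_cat; exists (A *m B *m invmx A), A; split=> //.
  by apply: prod_of_conj => //; rewrite ?mulmxV ?mulVmx.
by rewrite -!mulmxA mulVmx // mulmx1.
Qed.

Lemma prod_of_perm s t n (M : 'M[F]_n) : all (fun r => r != 0) s ->
  perm_eq s t -> prod_of s M -> prod_of t M.
Proof.
move=> hs st hM.
pose P t := all (fun r => r != 0) t /\ prod_of t M.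
suff [] : P t by [].
apply: (catCA_perm_ind (P := P) _ st (conj hs hM)) => s1 s2 s3.
rewrite /P !all_cat => -[/and3P[h1 h2 h3]].
rewrite catA => /prod_of_cat[A [B [hA hB ->]]]; rewrite h1 h2 h3; split=> //.
by rewrite catA; apply/prod_of_cat; exists A, B; split=> //; apply: prod_of_catC.
Qed.

End Products.

(** * Cyclic matrices and companion matrices *)
Section Cyclic.
Variable F : fieldType.

(** Subspaces stable under [A], as predicates: restricting one to a summand
    is then a mere composition of functions. *)
Definition stable_pred n (A : 'M[F]_n) (U : 'rV[F]_n -> Prop) : Prop :=
  (forall c u v, U u -> U v -> U (c *: u + v)) /\
  (forall u, U u -> U (u *m A)).

(** Impredicative form of cyclicity: it needs neither polynomials in [A] nor
    the rank of a family of iterates, and is inherited by block matrices. *)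
Definition cyclic_vec n (A : 'M[F]_n) (u : 'rV[F]_n) : Prop :=
  forall U, stable_pred A U -> U u -> forall w, U w.

(** Unlike [companionmx], the size is an argument independent of [p]. *)
Definition compan_mx n (p : {poly F}) : 'M[F]_n :=
  \matrix_(i, j) if i.+1 == n then - p`_j else (i.+1 == j :> nat)%:R.

Definition krylov n (A : 'M[F]_n) (u : 'rV[F]_n) : 'M[F]_n :=
  \matrix_(i < n) (u *m A ^+ i).

Lemma char_poly_compan n (p : {poly F}) :
  p \is monic -> size p = n.+1 -> char_poly (compan_mx n p) = p.
Proof.
move=> mp sp; rewrite -[RHS](companionmxK mp).
have en : n = (size p).-1 by rewrite sp.
subst n; congr char_poly; apply/matrixP=> i j; rewrite !mxE.
have d0 : (0 < (size p).-1)%N by apply: leq_ltn_trans (ltn_ord i).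
by rewrite -[in RHS]eqSS prednK.
Qed.

Lemma horner_mx_sum n (A : 'M[F]_n.+1) p :
  horner_mx A p = \sum_(i < size p) p`_i *: A ^+ i.
Proof.
rewrite -{1}[p]coefK poly_def linear_sum; apply: eq_bigr => i _.
by rewrite linearZ rmorphXn /= horner_mx_X.
Qed.

(** The last row is the Cayley-Hamilton theorem. *)
Lemma krylov_compan n (A : 'M[F]_n) u :
  krylov A u *m A = compan_mx n (char_poly A) *m krylov A u.
Proof.
case: n A u => [|n] A u; first by apply/matrixP=> -[].
apply/row_matrixP=> i; rewrite !row_mul rowK -mulmxA mulmxE -exprSr.
rewrite [RHS]mulmx_sum_row.
have [ei|ni] := eqVneq i.+1 n.+1; last first.
  have lti : (i.+1 < n.+1)%N by rewrite ltn_neqAle ni ltn_ord.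
  rewrite (bigD1 (Ordinal lti)) //= !mxE (negPf ni) eqxx scale1r rowK.
  rewrite big1 ?addr0 // => j; rewrite !mxE (negPf ni) eq_sym -val_eqE /=.
  by move/negPf->; rewrite scale0r.
under eq_bigr => j _ do rewrite !mxE ei eqxx rowK scaleNr.
have := Cayley_Hamilton A; rewrite horner_mx_sum size_char_poly big_ord_recr /=.
have /monicP := char_poly_monic A; rewrite lead_coefE size_char_poly /= => ->.
rewrite scale1r addrC ei => /eqP; rewrite addr_eq0 => /eqP->.
rewrite sumrN mulmxN mulmx_sumr; congr (- _); apply: eq_bigr => j _.
by rewrite -scalemxAr.
Qed.

Lemma krylov_sub n (A : 'M[F]_n) u : (u <= krylov A u)%MS.
Proof.
case: n A u => [|n] A u; first by rewrite [u]thinmx0 sub0mx.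
have {1}<- : row ord0 (krylov A u) = u by rewrite rowK expr0 mulmx1.
exact: row_sub.
Qed.

Lemma krylov_unit n (A : 'M[F]_n) u : cyclic_vec A u -> krylov A u \in unitmx.
Proof.
move=> cyc; rewrite -row_full_unit -sub1mx; apply/row_subP => i.
move: (row i _) => w; apply: (cyc (fun w => (w <= krylov A u)%MS)).
  split=> [c v w' hv hw'|v hv]; first by rewrite addmx_sub ?scalemx_sub.
  by apply: submx_trans (submxMr A hv) _; rewrite krylov_compan submxMl.
exact: krylov_sub.
Qed.

Lemma cyclic_similar_compan n (A : 'M[F]_n) u :
  cyclic_vec A u -> similar_mx A (compan_mx n (char_poly A)).
Proof.
move=> /krylov_unit uK; apply: similar_sym; exists (krylov A u), (invmx (krylov A u)).
by rewrite mulmxV // mulVmx // krylov_compan.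
Qed.

Lemma cyclic_similar m n (A : 'M[F]_m) u (B : 'M[F]_n) v :
  cyclic_vec A u -> cyclic_vec B v -> char_poly A = char_poly B -> similar_mx A B.
Proof.
move=> cA cB e; have := congr1 (size \o val) e; rewrite /= !size_char_poly => -[e1].
subst n; apply: similar_trans (cyclic_similar_compan cA) _; rewrite e.
exact/similar_sym/(cyclic_similar_compan cB).
Qed.

Lemma stable_predB n (A : 'M[F]_n) U : stable_pred A U ->
  forall u v, U u -> U v -> U (u - v).
Proof. by case=> lin _ u v hu hv; rewrite addrC -scaleN1r; apply: lin. Qed.

Lemma stable_predD n (A : 'M[F]_n) U : stable_pred A U ->
  forall u v, U u -> U v -> U (u + v).
Proof. by case=> lin _ u v hu hv; rewrite -[u]scale1r; apply: lin. Qed.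

Lemma stable_pred0 n (A : 'M[F]_n) U : stable_pred A U -> forall u, U u -> U 0.
Proof. by move=> h u hu; rewrite -(subrr u); apply: (stable_predB h). Qed.

Lemma stable_predZ n (A : 'M[F]_n) U : stable_pred A U ->
  forall c u, U u -> U (c *: u).
Proof.
move=> h c u hu; rewrite -[c *: u]addr0.
by apply: (proj1 h) => //; apply: (stable_pred0 h hu).
Qed.

Lemma stable_pred_span n (A : 'M[F]_n) U : stable_pred A U -> U 0 ->
  forall m (B : 'M[F]_(m, n)), (forall i, U (row i B)) -> forall c, U (c *m B).
Proof.
move=> hU U0 m B hB c; rewrite mulmx_sum_row.
apply: (big_ind U) => // [u v|i _]; first exact: (stable_predD hU).
exact: (stable_predZ hU).
Qed.

(** Membership of w A instead of w is again a stable predicate. *)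
Lemma cyclic_vecM n (A : 'M[F]_n) u : A \in unitmx -> cyclic_vec A u ->
  cyclic_vec A (u *m A).
Proof.
move=> uA cyc U hU hu w.
have -> : w = (w *m invmx A) *m A by rewrite mulmxKV.
apply: (cyc (fun w => U (w *m A))) => //; split=> [c x y hx hy|x hx].
  by rewrite mulmxDl -scalemxAl; apply: hU.1.
exact: hU.2.
Qed.

End Cyclic.

(** * Splitting off a companion block *)
Section CyclicSplit.
Variable F : fieldType.

Definition krylov_rows n (A : 'M[F]_n) (v : 'rV[F]_n) m : 'M[F]_(m, n) :=
  \matrix_(i < m) (v *m A ^+ i).

(** The entry (i, j) is v A^(i+j) w^T: its invertibility says at once that the
    first [m] iterates of [v] under [A] and of [w] under A^T are free and in
    duality. *)
Definition hankel n (A : 'M[F]_n) (v w : 'rV[F]_n) m : 'M[F]_m :=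
  krylov_rows A v m *m (krylov_rows A^T w m)^T.

Lemma hankel_tr n (A : 'M[F]_n) v w m : (hankel A v w m)^T = hankel A^T w v m.
Proof. by rewrite /hankel trmx_mul !trmxK. Qed.

Lemma trmx_exp n (A : 'M[F]_n) i : (A ^+ i)^T = A^T ^+ i.
Proof.
elim: i => [|i IH]; first by rewrite !expr0 trmx1.
by rewrite exprS exprSr -!mulmxE trmx_mul IH.
Qed.

Lemma hankelE n (A : 'M[F]_n) v w m i j :
  hankel A v w m i j = (v *m A ^+ (i + j) *m w^T) 0 0.
Proof.
have -> : hankel A v w m i j =
    (row i (krylov_rows A v m) *m (row j (krylov_rows A^T w m))^T) 0 0.
  by rewrite !mxE; apply: eq_bigr => k _; rewrite !mxE.
by rewrite !rowK trmx_mul -trmx_exp trmxK mulmxA exprD -mulmxE -!mulmxA.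
Qed.

Lemma antitriangular_unit m (H : 'M[F]_m) :
  (forall i j : 'I_m, (i + j < m)%N -> H i j = ((i + j)%N == m.-1)%:R) ->
  H \in unitmx.
Proof.
(* reversing the columns turns an antitriangular matrix into a triangular one *)
move=> hH; pose R : 'M[F]_m := \matrix_(i, j) (i == rev_ord j)%:R.
have HR i j : (H *m R) i j = H i (rev_ord j).
  rewrite mxE (bigD1 (rev_ord j)) //= mxE eqxx mulr1 big1 ?addr0 // => k.
  by rewrite mxE => /negPf->; rewrite mulr0.
suff : H *m R \in unitmx by rewrite unitmx_mul => /andP[].
have trig : is_trig_mx (H *m R).
  apply/is_trig_mxP => i j lij; rewrite HR hH /=.
    by rewrite ltn_eqF //; have := ltn_ord i; have := ltn_ord j; lia.
  by have := ltn_ord i; have := ltn_ord j; lia.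
rewrite unitmxE (det_trig trig) big1 ?unitr1 // => i _.
have li := ltn_ord i.
rewrite HR hH /= ?subnKC //; last by lia.
by have -> : (i + (m - i.+1))%N == m.-1 by lia.
Qed.

(** If v A^m were independent from the previous iterates, some linear form
    would vanish on them and not on v A^m; its Hankel matrix of order m + 1
    would be antitriangular, hence invertible. *)
Lemma hankel_max_sub n (A : 'M[F]_n) v m :
  (forall w, hankel A v w m.+1 \notin unitmx) -> row_free (krylov_rows A v m) ->
  (v *m A ^+ m <= krylov_rows A v m)%MS.
Proof.
move=> hmax fr; apply: contraT => nsub.
have fr1 : row_free (krylov_rows A v m.+1).
  apply: inj_row_free => c hc.
  have def_c : c *m krylov_rows A v m.+1 =
    (\row_(j < m) c 0 (widen_ord (leqnSn m) j)) *m krylov_rows A v m +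
    c 0 ord_max *: (v *m A ^+ m).
    rewrite [LHS]mulmx_sum_row [X in X + _]mulmx_sum_row big_ord_recr /= rowK.
    congr (_ + _).
    by apply: eq_bigr => j _; rewrite !rowK mxE.
  have c0 : c 0 ord_max = 0.
    apply/eqP; apply: contraNT nsub => c0.
    have := hc; rewrite def_c => /eqP; rewrite addrC addr_eq0 => /eqP h.
    by rewrite -(eqmx_scale _ c0) h -mulNmx submxMl.
  move: hc; rewrite def_c c0 scale0r addr0 => /eqP.
  rewrite mulmx_free_eq0 // => /eqP hr.
  apply/rowP=> j; rewrite mxE; case: (unliftP ord_max j) => [j' ->|-> //].
  have := congr1 (fun r : 'rV_m => r 0 j') hr; rewrite !mxE => <-.
  by congr (c 0 _); apply: val_inj; rewrite /= /bump leqNgt ltn_ord.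
case/row_freeP: fr1 => B hB.
pose w := (col ord_max B)^T.
have /negP[] := hmax w; apply: antitriangular_unit => i j lij.
rewrite hankelE trmxK colE.
have -> : v *m A ^+ (i + j) = row (Ordinal lij) (krylov_rows A v m.+1) by rewrite rowK.
rewrite rowE -!mulmxA (mulmxA _ B) hB mul1mx mxE (bigD1 (Ordinal lij)) //=.
rewrite !mxE !eqxx /= big1 ?addr0 => [|k]; first by rewrite mul1r -val_eqE andbT.
by rewrite !mxE eqxx /= eq_sym => /negPf->; rewrite mul0r.
Qed.

(** Such an [m] exists because the rank of a Hankel matrix is at most the
    size of [A]. *)
Lemma hankel_max n (A : 'M[F]_n.+1) :
  exists m, exists v, exists w, hankel A v w m.+1 \in unitmx /\
    forall v w, hankel A v w m.+2 \notin unitmx.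
Proof.
apply: contrapT => no.
have all_m m : exists v, exists w, hankel A v w m.+1 \in unitmx.
  elim: m => [|m [v [w h]]].
    exists (delta_mx 0 0), (delta_mx 0 0); apply: antitriangular_unit => i j _.
    rewrite [i]ord1 [j]ord1 hankelE expr0 mulmx1 trmx_delta mul_delta_mx.
    by rewrite mxE.
  apply: contrapT => no2; apply: no; exists m, v, w; split=> // v' w'.
  by apply/negP => h'; apply: no2; exists v', w'.
(* a Hankel matrix of order n + 2 cannot be invertible in size n + 1 *)
have [v [w]] := all_m n.+1; rewrite -row_free_unit /row_free /hankel.
have := mxrankM_maxl (krylov_rows A v n.+2) (krylov_rows A^T w n.+2)^T.
have := rank_leq_col (krylov_rows A v n.+2).
by move: (\rank _) (\rank _) => a b h1 h2 /eqP; lia.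
Qed.

Lemma krylov_rows_compan n (A : 'M[F]_n) v m : (v *m A ^+ m <= krylov_rows A v m)%MS ->
  exists p, [/\ p \is monic, size p = m.+1 &
               krylov_rows A v m *m A = compan_mx m p *m krylov_rows A v m].
Proof.
case/submxP=> c hc; exists ('X^m - rVpoly c).
have sc : (size (- rVpoly c) < size ('X^m : {poly F}))%N.
  by rewrite size_polyN size_polyXn ltnS size_poly.
split; first by rewrite monicE lead_coefDl // lead_coefXn.
  by rewrite size_polyDl // size_polyXn.
apply/row_matrixP=> i; rewrite !row_mul rowK -mulmxA mulmxE -exprSr.
rewrite [RHS]mulmx_sum_row.
have [ei|ni] := eqVneq i.+1 m; last first.
  have lti : (i.+1 < m)%N by rewrite ltn_neqAle ni ltn_ord.
  rewrite (bigD1 (Ordinal lti)) //= !mxE (negPf ni) eqxx scale1r rowK.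
  rewrite big1 ?addr0 // => j; rewrite !mxE (negPf ni) eq_sym -val_eqE /=.
  by move/negPf->; rewrite scale0r.
rewrite ei hc mulmx_sum_row; apply: eq_bigr => j _; congr (_ *: _).
rewrite !mxE ei eqxx coefB coefXn coef_rVpoly_ord.
by rewrite ltn_eqF // sub0r opprK.
Qed.

(** For a Hankel matrix of maximal order, both the span of the iterates of
    [v] and the orthogonal of the iterates of [w] are stable under [A], and they
    are complementary. *)
Lemma cyclic_split n (A : 'M[F]_n.+1) :
  exists m k (p : {poly F}) (A' : 'M[F]_k),
    [/\ p \is monic, size p = m.+2 & similar_mx A (block_mx (compan_mx m.+1 p) 0 0 A')].
Proof.
have [m [v [w [uH hmax]]]] := hankel_max A.
set P := krylov_rows A v m.+1; set R := krylov_rows A^T w m.+1.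
have PR : P *m R^T \in unitmx by [].
have frP : row_free P.
  apply: inj_row_free => c hc.
  by rewrite -[c](mulmxK PR) mulmxA hc !mul0mx.
have frR : row_free R.
  apply: inj_row_free => c hc.
  have uRP : R *m P^T \in unitmx by rewrite -unitmx_tr trmx_mul trmxK.
  by rewrite -[c](mulmxK uRP) mulmxA hc !mul0mx.
have hmax' v' w' : hankel A^T v' w' m.+2 \notin unitmx.
  by rewrite -hankel_tr unitmx_tr.
have [p [mp sp PA]] := krylov_rows_compan (hankel_max_sub (hmax v) frP).
have [q [mq sq RA]] := krylov_rows_compan (hankel_max_sub (hmax' w) frR).
pose K := row_base (kermx R^T).
have KR : K *m R^T = 0 by apply/sub_kermxP; rewrite eq_row_base.
have ARt : A *m R^T = R^T *m (compan_mx m.+1 q)^T.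
  by apply: trmx_inj; rewrite !trmx_mul !trmxK RA.
have /submxP[A' KA] : (K *m A <= K)%MS.
  by rewrite eq_row_base; apply/sub_kermxP; rewrite -mulmxA ARt mulmxA KR mul0mx.
exists m, (\rank (kermx R^T)), p, A'; split=> //.
have PA' : P *m A = compan_mx m.+1 p *m P by [].
set G := col_mx P K.
have frG : row_free G.
  apply: inj_row_free => c; rewrite -[c]hsubmxK mul_row_col => h.
  have c0 : lsubmx c = 0.
    rewrite -[lsubmx c](mulmxK PR) mulmxA -[lsubmx c *m P](addrK (rsubmx c *m K)).
    by rewrite h sub0r mulNmx -mulmxA KR mulmx0 oppr0 mul0mx.
  move: h; rewrite c0 mul0mx add0r => /eqP; rewrite mulmx_free_eq0 ?row_base_free //.
  by move/eqP->; rewrite row_mx0.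
have fuG : row_full G.
  rewrite /row_full; move: frG; rewrite /row_free => /eqP->.
  have := mxrank_ker R^T; rewrite mxrank_tr (eqP frR) => ->.
  have := rank_leq_col R; rewrite (eqP frR) => h; rewrite subnKC //.
have [Q GQ] := row_freeP frG; have [Q' QG] := row_fullP fuG.
have eQ : Q = Q' by rewrite -[Q]mul1mx -QG -mulmxA GQ mulmx1.
apply: similar_sym; exists G, Q; split=> //; first by rewrite eQ.
by rewrite /G mul_block_col [RHS]mul_col_mx !mul0mx addr0 add0r PA' KA.
Qed.

End CyclicSplit.

(** * Cyclic matrices that are products of two quadratic matrices *)
Section Realizable.
Variable F : fieldType.

Definition quads (al : F) (ts : seq F) : {poly F} :=
  \prod_(t <- ts) ('X^2 - t *: 'X + al%:P).

Lemma char_poly_ublock m n (A : 'M[F]_m) (B : 'M[F]_(m, n)) (D : 'M[F]_n) :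
  char_poly (block_mx A B 0 D) = char_poly A * char_poly D.
Proof.
rewrite /char_poly /char_poly_mx map_block_mx map_mx0 scalar_mx_block.
by rewrite opp_block_mx add_block_mx !oppr0 !add0r det_ublock.
Qed.

(** The off-diagonal block of (S - 1)(S - r) is
    (A - 1) b c + b c (D - r) = (r - 1) b c + (1 - r) b c. *)
Lemma quad_mx_block r m n (A : 'M[F]_m) (b : 'M[F]_(m, 1)) (c : 'rV[F]_n) D :
  quad_mx r A -> quad_mx r D -> A *m b = r *: b -> c *m D = c ->
  quad_mx r (block_mx A (b *m c) 0 D).
Proof.
rewrite /quad_mx => hA hD Ab cD.
rewrite !scalar_mx_block !opp_block_mx !add_block_mx mulmx_block.
rewrite ?(oppr0, addr0, mul0mx, mulmx0, hA, hD, add0r).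
suff -> : (A - 1%:M) *m (b *m c) + b *m c *m (D - r%:M) = 0 by rewrite block_mx0.
rewrite mulmxBl mulmxBr mul1mx mulmxA Ab -[b *m c *m D]mulmxA cD mul_mx_scalar.
by rewrite -scalemxAl addrA subrK subrr.
Qed.

Lemma quad_mx_diag r m n (A : 'M[F]_m) (D : 'M[F]_n) :
  quad_mx r A -> quad_mx r D -> quad_mx r (block_mx A 0 0 D).
Proof.
rewrite /quad_mx => hA hD.
rewrite !scalar_mx_block !opp_block_mx !add_block_mx mulmx_block.
by rewrite ?(oppr0, addr0, mul0mx, mulmx0, hA, hD, add0r) block_mx0.
Qed.

Lemma quad_mx_scalar r n (a : F) : a \in [:: 1; r] -> quad_mx r (a%:M : 'M[F]_n).
Proof.
rewrite /quad_mx !inE => /orP[] /eqP->; rewrite subrr ?mul0mx ?mulmx0 //.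
Qed.

Definition mx2 (a b c d : F) : 'M[F]_2 :=
  \matrix_(i, j) if i == 0 then (if j == 0 then a else b)
                 else (if j == 0 then c else d).

Lemma mx2M a b c d a' b' c' d' : mx2 a b c d *m mx2 a' b' c' d' =
  mx2 (a * a' + b * c') (a * b' + b * d') (c * a' + d * c') (c * b' + d * d').
Proof.
apply/matrixP=> i j; rewrite !mxE !big_ord_recl big_ord0 addr0 !mxE.
by case: i => -[|[|//]] ?; case: j => -[|[|//]] ?.
Qed.

Lemma mx2B a b c d e : mx2 a b c d - e%:M = mx2 (a - e) b c (d - e).
Proof.
apply/matrixP=> i j; rewrite !mxE.
by case: i => -[|[|//]] ?; case: j => -[|[|//]] ? //=; rewrite ?mulr0n ?subr0.
Qed.

Lemma mx20 : mx2 0 0 0 0 = 0.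
Proof. by apply/matrixP=> i j; rewrite !mxE; case: ifP; case: ifP. Qed.

Lemma char_poly_mx2 a b c d :
  char_poly (mx2 a b c d) = 'X^2 - (a + d) *: 'X + (a * d - b * c)%:P.
Proof.
rewrite /char_poly (expand_det_row _ ord0) !big_ord_recl big_ord0 addr0.
rewrite /cofactor !det_mx11 !mxE /= !mulr1n !mulr0n !sub0r expr0 expr1 mul1r.
by rewrite polyCB !polyCM -mul_polyC polyCD; ring.
Qed.

(** The row [b] is required to be cyclic for S T and fixed by [S] at the same
    time: by [quad_mx_block] this is what allows a further block on top of [S]. *)
Definition realizable (rS rT : F) (q : {poly F}) : Prop :=
  exists n, exists S T : 'M[F]_n, exists b : 'rV[F]_n,
    [/\ quad_mx rS S, quad_mx rT T, b *m S = b, cyclic_vec (S *m T) b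
      & char_poly (S *m T) = q].

Lemma realizable1 rS rT : realizable rS rT 1.
Proof.
exists 0%N, 0, 0, 0; split; rewrite /quad_mx; try by apply/matrixP=> -[].
- by rewrite mulmx0.
- by move=> U _ U0 w; rewrite [w]thinmx0 -[0](thinmx0 0).
by rewrite /char_poly det_mx00.
Qed.

Lemma char_poly_scalar1 (a : F) : char_poly (a%:M : 'M_1) = 'X - a%:P.
Proof. by rewrite /char_poly det_mx11 !mxE eqxx !mulr1n. Qed.

Lemma realizable_linear rS rT a : a \in [:: 1; rT] -> realizable rS rT ('X - a%:P).
Proof.
move=> ha; exists 1%N, 1%:M, a%:M, 1%:M; split.
- by apply: quad_mx_scalar; rewrite inE eqxx.
- exact: quad_mx_scalar.
- by rewrite mulmx1.
- move=> U hU U1 w; rewrite [w]mx11_scalar -scalemx1.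
  exact: stable_predZ hU _ _ U1.
by rewrite mul1mx char_poly_scalar1.
Qed.

Lemma stable_pred_block m n (P1 : 'M[F]_m) K (P2 : 'M[F]_n) U :
  stable_pred (block_mx P1 K 0 P2) U -> stable_pred P2 (fun w => U (row_mx 0 w)).
Proof.
case=> lin st; split=> [c u v hu hv|u hu].
  by have := lin c _ _ hu hv; rewrite scale_row_mx add_row_mx scaler0 addr0.
by have := st _ hu; rewrite mul_row_block !mul0mx mulmx0 addr0 add0r.
Qed.

(** The new block of S T is [[1, 1], [s, s + rS rT]], of determinant rS rT
    and of arbitrary trace.  Starting from the first basis vector, the iterates fill
    the new block, then reach b T = b (S T) in the old one, which is cyclic there. *)
Lemma realizable_quad rS rT t q : rS != 0 -> rT != 0 ->
  realizable rS rT q -> realizable rS rT (('X^2 - t *: 'X + (rS * rT)%:P) * q).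
Proof.
move=> rS0 rT0 [n [S [T [b [hS hT bS cyc cq]]]]].
(* the trace 1 + s + rS rT of the new block must be t *)
set s := t - 1 - rS * rT.
pose S1 := mx2 1 0 s rS; pose T1 := mx2 1 1 0 rT.
pose e0 : 'rV[F]_2 := delta_mx 0 0; pose e1 : 'rV[F]_2 := delta_mx 0 1.
pose f1 : 'cV[F]_2 := delta_mx 1 0.
have e0f1 : e0 *m f1 = 0 by rewrite mul_delta_mx_0.
have e1f1 : e1 *m f1 = 1%:M.
  by rewrite mul_delta_mx; apply/matrixP=> i j; rewrite !mxE !ord1.
have PE : block_mx S1 (f1 *m b) 0 S *m block_mx T1 0 0 T =
          block_mx (S1 *m T1) (f1 *m (b *m T)) 0 (S *m T).
  by rewrite mulmx_block !mulmx0 !mul0mx !addr0 !add0r mulmxA.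
exists (2 + n)%N, (block_mx S1 (f1 *m b) 0 S), (block_mx T1 0 0 T), (row_mx e0 0).
rewrite PE; split.
- apply: quad_mx_block => //.
    by rewrite /quad_mx !mx2B mx2M -mx20; congr mx2; ring.
  apply/colP=> i; rewrite !mxE !big_ord_recl big_ord0 addr0 !mxE.
  by case: i => -[|[|//]] ? /=; ring.
- apply: quad_mx_diag => //.
  by rewrite /quad_mx !mx2B mx2M -mx20; congr mx2; ring.
- rewrite mul_row_block !mul0mx !addr0 mulmxA e0f1 mul0mx.
  congr row_mx; apply/rowP=> i; rewrite -rowE !mxE.
  by case: i => -[|[|//]] ? /=.
- move=> U hU U0.
  have U1 : U (row_mx e1 0).
    have := stable_predB hU (hU.2 _ U0) U0.
    rewrite mul_row_block !mul0mx !addr0 (mulmxA e0 f1) e0f1 mul0mx opp_row_mx.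
    rewrite add_row_mx subr0.
    suff -> : e0 *m (S1 *m T1) - e0 = e1 by [].
    apply/rowP=> i; rewrite -rowE mx2M !mxE.
    by case: i => -[|[|//]] ? /=; ring.
  have Ul (v : 'rV[F]_2) : U (row_mx v 0).
    have -> : row_mx v (0 : 'rV_n) = v 0 0 *: row_mx e0 0 + v 0 1 *: row_mx e1 0.
      rewrite !scale_row_mx add_row_mx !scaler0 addr0; congr row_mx.
      apply/rowP=> i; rewrite !mxE.
      case: i => -[|[|//]] ? /=; rewrite ?mulr1 ?mulr0 ?addr0 ?add0r;
        by congr (v _ _); apply: val_inj.
    by apply: hU.1 => //; apply: stable_predZ hU _ _ U1.
  have hU2 := stable_pred_block hU.
  have Ub : U (row_mx 0 (b *m T)).
    have := stable_predB hU (hU.2 _ U1) (Ul (e1 *m (S1 *m T1))).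
    rewrite mul_row_block !mul0mx !addr0 opp_row_mx add_row_mx subrr subr0.
    by rewrite (mulmxA e1 f1) e1f1 mul1mx.
  have cyc2 : cyclic_vec (S *m T) (b *m T).
    rewrite -{1}bS -mulmxA; apply: cyclic_vecM => //.
    by rewrite unitmx_mul (quad_mx_unit rS0 hS) (quad_mx_unit rT0 hT).
  move=> w; rewrite -[w]hsubmxK.
  have -> : row_mx (lsubmx w) (rsubmx w) = row_mx (lsubmx w) 0 + row_mx 0 (rsubmx w).
    by rewrite add_row_mx addr0 add0r.
  by apply: (stable_predD hU); [exact: Ul | exact: (cyc2 _ hU2 Ub)].
rewrite char_poly_ublock cq; congr (_ * _); rewrite mx2M char_poly_mx2 /s.
by congr (_ - _ *: _ + _%:P); ring.
Qed.

Lemma realizable_quads rS rT ts q : rS != 0 -> rT != 0 ->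
  realizable rS rT q -> realizable rS rT (quads (rS * rT) ts * q).
Proof.
move=> rS0 rT0 hq; rewrite /quads; elim: ts => [|t ts IH].
  by rewrite big_nil mul1r.
by rewrite big_cons -mulrA; apply: realizable_quad.
Qed.

Lemma realizable_prod rS rT q n (P : 'M[F]_n) u :
  realizable rS rT q -> cyclic_vec P u -> char_poly P = q ->
  prod_of [:: rS; rT] P.
Proof.
case=> m [S [T [b [hS hT _ cyc cq]]]] cP eP.
have := cyclic_similar cP cyc; rewrite eP cq => /(_ erefl)/prod_of_similar; apply.
by exists S, T; split=> //; exists T, 1%:M; rewrite mulmx1.
Qed.

(** The extra 1 x 1 block on top of [S] must be [rS] for [S] to keep its
    type.  The resulting cyclic vector is not fixed by [S], so that this extension
    can be performed only once. *)
Lemma realizable_top_prod rS rT a q n (P : 'M[F]_n) u :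
  rS != 0 -> rT != 0 -> a \in [:: 1; rT] ->
  realizable rS rT q -> cyclic_vec P u ->
  char_poly P = ('X - (rS * a)%:P) * q -> prod_of [:: rS; rT] P.
Proof.
move=> rS0 rT0 ha [m [S [T [b [hS hT bS cyc cq]]]]] cP eP.
pose S2 := block_mx (rS%:M : 'M_1) (1%:M *m b) 0 S.
pose T2 := block_mx (a%:M : 'M_1) 0 0 T.
have PE : S2 *m T2 = block_mx (rS * a)%:M (b *m T) 0 (S *m T).
  rewrite mulmx_block !mulmx0 !mul0mx !addr0 !add0r mul1mx.
  by rewrite -scalar_mxM.
have cyc2 : cyclic_vec (S2 *m T2) (row_mx 1%:M 0).
  rewrite PE => U hU U1.
  have Ul (c : 'rV[F]_1) : U (row_mx c 0).
    have -> : row_mx c (0 : 'rV_m) = c 0 0 *: row_mx 1%:M 0.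
      by rewrite scale_row_mx scaler0 scalemx1 -mx11_scalar.
    exact: stable_predZ hU _ _ U1.
  have Ub : U (row_mx 0 (b *m T)).
    have := stable_predB hU (hU.2 _ U1) (Ul (1%:M *m (rS * a)%:M)).
    by rewrite mul_row_block !mul0mx !addr0 opp_row_mx add_row_mx subrr subr0 mul1mx.
  have hU2 := stable_pred_block hU.
  have cycT : cyclic_vec (S *m T) (b *m T).
    rewrite -{1}bS -mulmxA; apply: cyclic_vecM => //.
    by rewrite unitmx_mul (quad_mx_unit rS0 hS) (quad_mx_unit rT0 hT).
  move=> w; rewrite -[w]hsubmxK.
  have -> : row_mx (lsubmx w) (rsubmx w) = row_mx (lsubmx w) 0 + row_mx 0 (rsubmx w).
    by rewrite add_row_mx addr0 add0r.
  by apply: (stable_predD hU); [exact: Ul | exact: (cycT _ hU2 Ub)].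
have e2 : char_poly (S2 *m T2) = char_poly P.
  by rewrite PE char_poly_ublock char_poly_scalar1 cq eP.
apply: prod_of_similar (cyclic_similar cP cyc2 (esym e2)) _.
exists S2, T2; split=> //; last first.
  exists T2, 1%:M; rewrite mulmx1; split=> //; apply: quad_mx_diag => //.
  exact: quad_mx_scalar.
apply: quad_mx_block => //; last by rewrite mul_scalar_mx.
by apply: quad_mx_scalar; rewrite !inE eqxx orbT.
Qed.

End Realizable.

(** * Factoring a companion block *)
Section CompanionStep.
Variable F : fieldType.

(** As for [cyclic_vec], a span (here that of the iterates of [g] and of the
    fixed vectors of [Y]) is described by the stable predicates containing it. *)
Definition cyclic_mod_fixed n (Y : 'M[F]_n) (g : 'rV[F]_n) : Prop :=
  forall U, stable_pred Y U -> U g -> (forall z, z *m Y = z -> U z) -> forall w, U w.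

Lemma det_compan n (p : {poly F}) : p \is monic -> size p = n.+1 ->
  \det (compan_mx n p) = (-1) ^+ n * p`_0.
Proof.
move=> mp sp; rewrite -{2}(char_poly_compan mp sp) char_poly_det mulrA -exprMn.
by rewrite mulrNN mulr1 expr1n mul1r.
Qed.

Lemma delta_compan n (p : {poly F}) (i j : 'I_n) : i.+1 = j ->
  delta_mx 0 i *m compan_mx n p = delta_mx 0 j :> 'rV_n.
Proof.
move=> ij; rewrite -rowE; apply/rowP=> k; rewrite !mxE eqxx /=.
by rewrite ltn_eqF ?ij // eq_sym.
Qed.

(** The link is the rank one block [f *m u'] of [X]: it sends the last basis
    vector of the new block to the cyclic vector [u'] of the old one.  The block of
    [Y] above the diagonal is forced by Y X being block diagonal.  Cyclicity
    modulo fixed vectors is stated for u X^-1 because, modulo fixed vectors, u X^-1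
    is a nonzero multiple of (e_last, - u' X'^-1), on which Y - y acts as
    - u' X'^-1 Y' in the old block: the vector propagates to the next block. *)
Lemma compan_step m k (c p : {poly F}) (X' Y' : 'M[F]_k) u' :
  c \is monic -> size c = m.+2 -> p \is monic -> size p = m.+2 -> p`_0 != 0 ->
  X' \in unitmx -> Y' \in unitmx -> cyclic_vec X' u' ->
  cyclic_mod_fixed Y' (u' *m invmx X') ->
  exists (X Y : 'M[F]_(m.+1 + k)) u,
    [/\ block_mx (compan_mx m.+1 c) 0 0 (Y' *m X') = Y *m X,
        X \in unitmx, cyclic_vec X u & cyclic_mod_fixed Y (u *m invmx X)] /\
    [/\ char_poly X = p * char_poly X' &
        char_poly Y = ('X - 1) ^+ m * ('X - (c`_0 / p`_0)%:P) * char_poly Y'].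
Proof.
move=> mc sc mp sp p0 uX' uY' cycX'.
set g' := u' *m invmx X' => cycY'.
have g'X' : g' *m X' = u' by rewrite mulmxKV.
clearbody g'.
set C := compan_mx m.+1 c; set P := compan_mx m.+1 p.
have detP : \det P = (-1) ^+ m.+1 * p`_0 by apply: det_compan.
have detC : \det C = (-1) ^+ m.+1 * c`_0 by apply: det_compan.
have uP : P \in unitmx.
  by rewrite unitmxE detP unitfE mulf_neq0 // expf_neq0 // oppr_eq0 oner_eq0.
pose f : 'cV[F]_m.+1 := delta_mx ord_max 0.
pose d : 'rV[F]_m.+1 := \row_j (p`_j - c`_j).
(* two companion matrices differ by their last rows only *)
have defC : C = P + f *m d.
  apply/matrixP=> i j; rewrite !mxE big_ord1 !mxE eqxx andbT -val_eqE /= eqSS.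
  by case: eqP => _; rewrite ?mul1r ?mul0r ?addr0 // addrA addNr add0r.
pose d' := d *m invmx P; pose Y1 := 1%:M + f *m d'.
have Y1P : (1%:M + f *m d') *m P = C by rewrite mulmxDl mul1mx -mulmxA mulmxKV.
have vY1 (v : 'rV_m.+1) : v *m Y1 = v + v *m f *m d' by rewrite mulmxDr mulmx1 mulmxA.
clearbody d'.
pose X := block_mx P (f *m u') 0 X'.
pose Y := block_mx Y1 (- (Y1 *m f *m g')) 0 Y'.
pose e0 : 'rV[F]_m.+1 := delta_mx 0 0; pose el : 'rV[F]_m.+1 := delta_mx 0 ord_max.
have elf : el *m f = 1%:M.
  by rewrite mul_delta_mx; apply/matrixP=> i j; rewrite !mxE !ord1.
have uX : X \in unitmx.
  by rewrite unitmxE det_ublock unitrM -!unitmxE uP.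
pose a := e0 *m invmx P.
have aP : a *m P = e0 by rewrite mulmxKV.
clearbody a.
pose g := row_mx a (- (a *m f *m g')).
have gE : g = row_mx e0 0 *m invmx X.
  rewrite -[LHS](mulmxK uX) mul_row_block aP mulmx0 addr0 mulNmx -!mulmxA g'X'.
  by rewrite subrr.
have al1 : a 0 ord_max * - p`_0 = 1.
  have := congr1 (fun r : 'rV_m.+1 => r 0 0) aP; rewrite /= [LHS]mxE.
  rewrite (bigD1 ord_max) //= big1 => [|j nj]; last first.
    by rewrite mxE eqSS -val_eqE /= in nj *; rewrite (negPf nj) mulr0.
  by rewrite addr0 !mxE !eqxx.
have afN0 : (a *m f) 0 0 != 0.
  rewrite -[a *m f]/(a *m delta_mx ord_max ord0) -colE mxE.
  by apply/eqP=> a0; move/eqP: al1; rewrite a0 mul0r eq_sym oner_eq0.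
exists X, Y, (row_mx e0 0); split; split=> //.
- rewrite mulmx_block !mul0mx !mulmx0 !addr0 add0r Y1P.
  by rewrite mulNmx -!mulmxA g'X' subrr.
- move=> U hU U0.
  have Ue i : (i < m.+1)%N -> U (row_mx (delta_mx 0 (inord i)) 0).
    elim: i => [|i IH] hi.
      by rewrite (_ : inord 0 = 0) //; apply/val_inj; rewrite /= inordK.
    have := hU.2 _ (IH (ltnW hi)).
    rewrite mul_row_block !mul0mx !addr0 mulmxA mul_delta_mx_0 ?mul0mx; last first.
      by rewrite -val_eqE /= inordK ?ltn_eqF // ltnW.
    by rewrite (@delta_compan _ _ _ (inord i.+1)) // !inordK // ltnW.
  have Ul (v : 'rV[F]_m.+1) : U (row_mx v 0).
    have -> : row_mx v (0 : 'rV_k) = v *m row_mx 1%:M 0.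
      by rewrite mul_mx_row mulmx1 mulmx0.
    apply: (stable_pred_span hU); first exact: (stable_pred0 hU U0).
    move=> i; rewrite row_row_mx row0 row1.
    by have := Ue i (ltn_ord i); rewrite inord_val.
  have hU2 := stable_pred_block hU.
  have Uu' : U (row_mx 0 u').
    have := stable_predB hU (hU.2 _ (Ul el)) (Ul (el *m P)).
    rewrite mul_row_block !mul0mx !addr0 opp_row_mx add_row_mx subrr subr0.
    by rewrite mulmxA elf mul1mx.
  move=> w; rewrite -[w]hsubmxK.
  have -> : row_mx (lsubmx w) (rsubmx w) = row_mx (lsubmx w) 0 + row_mx 0 (rsubmx w).
    by rewrite add_row_mx addr0 add0r.
  by apply: (stable_predD hU); [exact: Ul | exact: (cycX' _ hU2 Uu')].
- rewrite -gE => U hU Ug Ufix.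
  have Uv (v : 'rV[F]_m.+1) : v *m f = 0 -> U (row_mx v 0).
    move=> vf; apply: Ufix; rewrite mul_row_block !mul0mx !addr0 mulmxN !mulmxA vY1 vf.
    by rewrite !mul0mx addr0 vf mul0mx oppr0.
  have Uz (z : 'rV[F]_k) : z *m Y' = z -> U (row_mx 0 z).
    by move=> hz; apply: Ufix; rewrite mul_row_block !mul0mx mulmx0 addr0 add0r hz.
  have dec (v : 'rV[F]_m.+1) : (v - (v *m f) 0 0 *: el) *m f = 0.
    by rewrite mulmxBl -scalemxAl elf scalemx1 -mx11_scalar subrr.
  have Uh : U (row_mx el (- g')).
    have := stable_predB hU Ug (Uv _ (dec a)).
    rewrite opp_row_mx add_row_mx oppr0 addr0 opprB addrC subrK => h.
    have := stable_predZ hU ((a *m f) 0 0)^-1 h.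
    rewrite scale_row_mx scalerA mulVf // scale1r [a *m f]mx11_scalar mul_scalar_mx.
    by rewrite scalerN scalerA mxE eqxx mulr1n mulVf // scale1r.
  have UgY : U (row_mx 0 (g' *m Y')).
    have h1 := stable_predB hU (hU.2 _ Uh) Uh.
    have h2 := stable_predB hU
      (stable_predB hU h1 (stable_predZ hU ((d' *m f) 0 0) Uh)) (Uv _ (dec d')).
    have -> : row_mx 0 (g' *m Y') = -1 *: row_mx 0 (- (g' *m Y')) :> 'rV_(m.+1 + k).
      by rewrite scale_row_mx scaler0 scaleN1r opprK.
    apply: (stable_predZ hU); move: h2.
    rewrite mul_row_block mulmx0 addr0 vY1 elf mul1mx.
    rewrite mulmxN !mulmxA vY1 elf mul1mx (mulmxDl el) elf !mulmxDl mul1mx mulNmx.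
    rewrite [d' *m f]mx11_scalar mul_scalar_mx.
    rewrite scale_row_mx !opp_row_mx !add_row_mx.
    rewrite mxE eqxx mulr1n.
    suff -> : el + d' - el - (d' *m f) 0 0 *: el - (d' - (d' *m f) 0 0 *: el) = 0.
      suff -> : - (g' + (d' *m f) 0 0 *: g') - g' *m Y' - - g' -
        (d' *m f) 0 0 *: - g' - 0 = - (g' *m Y') by [].
      by apply/rowP=> i; rewrite !mxE; ring.
    by apply/rowP=> i; rewrite !mxE; ring.
  have Ur (w : 'rV[F]_k) : U (row_mx 0 w).
    have -> : w = w *m invmx Y' *m Y' by rewrite mulmxKV.
    apply: (cycY' (fun w => U (row_mx 0 (w *m Y')))) => [||z hz].
    - have hU2 : stable_pred Y' (fun w => U (row_mx 0 w)) := stable_pred_block hU.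
      split=> [c0 x y hx hy|x hx]; last exact: hU2.2.
      by rewrite mulmxDl -scalemxAl; apply: hU2.1.
    - exact: UgY.
    by rewrite hz; apply: Uz.
  have Uel : U (row_mx el 0).
    by have := stable_predD hU Uh (Ur g'); rewrite add_row_mx addr0 addNr.
  move=> w; rewrite -[w]hsubmxK.
  have -> : row_mx (lsubmx w) (rsubmx w) = row_mx (lsubmx w) 0 + row_mx 0 (rsubmx w).
    by rewrite add_row_mx addr0 add0r.
  apply: (stable_predD hU) => //; move: (lsubmx w) => v.
  have := stable_predD hU (Uv _ (dec v)) (stable_predZ hU ((v *m f) 0 0) Uel).
  by rewrite scale_row_mx scaler0 add_row_mx addr0 subrK.
- by rewrite char_poly_ublock char_poly_compan.
rewrite char_poly_ublock; congr (_ * _).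
have Y1E i j : Y1 i j = (i == j)%:R + (i == ord_max)%:R * d' 0 j.
  by rewrite !mxE big_ord1 !mxE eqxx andbT.
have trig : is_trig_mx Y1.
  apply/is_trig_mxP => i j lij; rewrite Y1E -!val_eqE /= ltn_eqF //.
  by rewrite ltn_eqF ?mul0r ?addr0 //; apply: leq_trans lij _; rewrite -ltnS.
have diag (i : 'I_m) : Y1 (widen_ord (leqnSn m) i) (widen_ord (leqnSn m) i) = 1.
  by rewrite Y1E eqxx -val_eqE /= ltn_eqF // mul0r addr0.
(* y is obtained as det C / det P, the signs of the two determinants agreeing *)
have detY1 : Y1 ord_max ord_max = c`_0 / p`_0.
  have <- : \det Y1 = Y1 ord_max ord_max.
    rewrite (det_trig trig) big_ord_recr /= big1 ?mul1r // => i _; exact: diag.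
  apply: (mulIf p0); rewrite divfK //.
  have s0 : (-1) ^+ m.+1 != 0 :> F by rewrite expf_neq0 // oppr_eq0 oner_eq0.
  by apply: (mulfI s0); rewrite mulrCA -detP -detC -Y1P det_mulmx.
rewrite (char_poly_trig trig) big_ord_recr /= detY1; congr (_ * _).
by under eq_bigr => i _ do rewrite diag; rewrite prodr_const card_ord.
Qed.

End CompanionStep.

(** * Matrices that are cyclic modulo their fixed vectors *)
Section ModFixed.
Variable F : fieldType.

Lemma row_base_cyclic n (Y : 'M[F]_n) g :
  let B := row_base (krylov Y g) in
  exists (C : 'M[F]_(\rank (krylov Y g))) v,
    cyclic_vec C v /\ B *m Y = C *m B.
Proof.
move=> B; have frB : row_free B by apply: row_base_free.
have eB : (B :=: krylov Y g)%MS by apply: eq_row_base.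
clearbody B.
have /submxP[C BY] : (B *m Y <= B)%MS.
  by rewrite !eB (eqmxMr _ eB) krylov_compan submxMl.
have /submxP[v gB] : (g <= B)%MS by rewrite eB krylov_sub.
exists C, v; split=> // U hU Uv w.
have powB i : v *m C ^+ i *m B = g *m Y ^+ i.
  elim: i => [|i IH]; first by rewrite !expr0 !mulmx1.
  by rewrite !exprSr -!mulmxE !mulmxA -IH -[LHS]mulmxA -[RHS]mulmxA BY.
have Upow i : U (v *m C ^+ i).
  elim: i => [|i IH]; first by rewrite expr0 mulmx1.
  by rewrite exprSr -mulmxE mulmxA; apply: hU.2.
have /submxP[c wB] : (w *m B <= krylov Y g)%MS by rewrite -eB submxMl.
have -> : w = c *m krylov_rows C v n.
  apply: (row_free_inj frB); rewrite wB -mulmxA; congr (_ *m _).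
  by apply/row_matrixP=> i; rewrite row_mul !rowK powB.
by apply: (stable_pred_span hU) => [|i]; [exact: stable_pred0 hU _ Uv | rewrite rowK].
Qed.

(** A complement of the span of the iterates of [g] can be chosen inside
    the space of fixed vectors. *)
Lemma cyclic_mod_fixed_split n (Y : 'M[F]_n) g : cyclic_mod_fixed Y g ->
  exists d k (C : 'M[F]_d) v,
    cyclic_vec C v /\ similar_mx Y (block_mx C 0 0 (1%:M : 'M_k)).
Proof.
move=> cyc; have [C [v [cC BY]]] := row_base_cyclic Y g.
set K := krylov Y g in C v cC BY *; set B := row_base K in BY *.
pose L := kermx (Y - 1%:M); pose Z := row_base (L :\: K)%MS.
have eB : (B :=: K)%MS by apply: eq_row_base.
have eZ : (Z :=: L :\: K)%MS by apply: eq_row_base.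
exists (\rank K), (\rank (L :\: K)), C, v; split=> //.
have ZY : Z *m Y = Z.
  apply/eqP; rewrite -subr_eq0 -[X in _ - X]mulmx1 -mulmxBr; apply/eqP/sub_kermxP.
  by rewrite eZ diffmxSl.
have KL : (1%:M <= K + L)%MS.
  apply/row_subP => i; move: (row i _) => w.
  apply: (cyc (fun w => (w <= K + L)%MS)) => [||z zY].
  - split=> [c x y hx hy|x hx]; first by rewrite addmx_sub ?scalemx_sub.
    apply: submx_trans (submxMr Y hx) _; rewrite addsmxMr addsmxS //.
      by rewrite krylov_compan submxMl.
    have -> : L *m Y = L; last by [].
    apply/eqP; rewrite -subr_eq0 -[X in _ - X]mulmx1 -mulmxBr; apply/eqP.
    exact: mulmx_ker.
  - by apply: submx_trans (addsmxSl _ _); apply: krylov_sub.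
  - apply: submx_trans (addsmxSr _ _); apply/sub_kermxP.
    by rewrite mulmxBr zY mulmx1 subrr.
have KZ : (1%:M <= K + (L :\: K))%MS.
  apply: submx_trans KL _; rewrite addsmx_sub addsmxSl /=.
  rewrite -(addsmx_diff_cap_eq L K) addsmx_sub addsmxSr /=.
  by apply: submx_trans (capmxSr _ _) (addsmxSl _ _).
set G := col_mx B Z.
have eG : (G :=: K + (L :\: K))%MS.
  by apply: eqmx_trans (eqmx_sym (addsmxE _ _)) _; apply: adds_eqmx.
have fuG : row_full G by rewrite -sub1mx eG.
have frG : row_free G.
  rewrite /row_free eG mxrank_disjoint_sum //.
  by rewrite capmxC capmx_diff.
have [Q GQ] := row_freeP frG; have [Q' QG] := row_fullP fuG.
have eQ : Q = Q' by rewrite -[Q]mul1mx -QG -mulmxA GQ mulmx1.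
apply: similar_sym; exists G, Q; split=> //; first by rewrite eQ.
by rewrite /G mul_block_col [RHS]mul_col_mx !mul0mx addr0 add0r mul1mx BY ZY.
Qed.

Lemma similar_block_diag m1 m2 n1 n2 (A : 'M[F]_m1) (A' : 'M[F]_m2)
  (B : 'M[F]_n1) (B' : 'M[F]_n2) :
  similar_mx A A' -> similar_mx B B' ->
  similar_mx (block_mx A 0 0 B) (block_mx A' 0 0 B').
Proof.
case=> P [Q [PQ QP AP]] [R [S [RS SR BR]]].
exists (block_mx P 0 0 R), (block_mx Q 0 0 S).
rewrite !mulmx_block !mulmx0 !mul0mx !addr0 !add0r PQ QP RS SR AP BR.
by rewrite -!scalar_mx_block.
Qed.

Lemma prod_of_diag s m n (A : 'M[F]_m) (B : 'M[F]_n) :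
  prod_of s A -> prod_of s B -> prod_of s (block_mx A 0 0 B).
Proof.
elim: s A B => [|r s IH] A B /=; first by move=> -> ->; rewrite -scalar_mx_block.
case=> [A1 [A2 [h1 h2 ->]]] [B1 [B2 [h3 h4 ->]]].
exists (block_mx A1 0 0 B1), (block_mx A2 0 0 B2).
split; [exact: quad_mx_diag | exact: IH |].
by rewrite mulmx_block !mulmx0 !mul0mx !addr0 !add0r.
Qed.

Lemma prod_of_1 s n : prod_of s (1%:M : 'M[F]_n).
Proof.
elim: s => [|r s IH] //=; exists 1%:M, 1%:M; split=> //; last by rewrite mulmx1.
by apply: quad_mx_scalar; rewrite inE eqxx.
Qed.

(** Products of x - 1 and of quadratic factors whose two roots are mutually
    inverse: the characteristic polynomials allowed for [Y]. *)
Inductive recip_poly : {poly F} -> Prop :=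
| recip_poly1 : recip_poly 1
| recip_poly_lin q : recip_poly q -> recip_poly (('X - 1) * q)
| recip_poly_quad t q : recip_poly q -> recip_poly (('X^2 - t *: 'X + 1) * q).

Lemma XsubC_neq0 (a : F) : 'X - a%:P != 0.
Proof. by rewrite polyXsubC_eq0. Qed.

Lemma recip_poly_exp q k : recip_poly q -> recip_poly (('X - 1) ^+ k * q).
Proof.
move=> hq; elim: k => [|k IH]; first by rewrite expr0 mul1r.
by rewrite exprS -mulrA; apply: recip_poly_lin.
Qed.

(** When x - 1 divides x^2 - t x + 1, then t = 2 and that factor is
    (x - 1)^2; hence removing a factor x - 1 stays within the class. *)
Lemma recip_poly_cancel r : recip_poly r -> forall q, r = ('X - 1) * q -> recip_poly q.
Proof.
have X10 : 'X - 1 != 0 :> {poly F} by rewrite -polyC1 XsubC_neq0.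
elim=> {r} [q /(congr1 (horner^~ 1))|r hr IH q /(mulfI X10) <- //|t r hr IH q].
  by rewrite /= !hornerE subrr mul0r => /eqP; rewrite oner_eq0.
have [-> e|t2 e] := eqVneq t 2.
  have <- : ('X - 1) * r = q; last exact: recip_poly_lin.
  apply: (mulfI X10); rewrite -e mulrA; congr (_ * r).
  by rewrite -mul_polyC polyC_natr; ring.
have /factor_theorem[r' er] : root r 1.
  have /(congr1 (horner^~ 1)) := e; rewrite /= !hornerE subrr mul0r => /eqP.
  rewrite mulf_eq0 => /orP[/eqP h|//]; case/eqP: t2.
  by apply/eqP; rewrite -subr_eq0 -oppr_eq0; apply/eqP; rewrite -h; ring.
rewrite polyC1 mulrC in er; have hr' := IH _ er.
have <- : ('X^2 - t *: 'X + 1) * r' = q; last exact: recip_poly_quad.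
by apply: (mulfI X10); rewrite -e er mulrCA.
Qed.

(** Pairs of factors x - 1 are absorbed as x^2 - 2 x + 1. *)
Lemma recip_poly_normal q : recip_poly q ->
  exists b : bool, exists ts, q = quads 1 ts * ('X - 1%:P) ^+ b.
Proof.
elim=> {q} [|q _ [b [ts ->]]|t q _ [b [ts ->]]].
- by exists false, [::]; rewrite /quads big_nil expr0 mulr1.
- case: b; last by exists true, ts; rewrite /= expr0 mulr1 expr1 polyC1 mulrC.
  exists false, (2 :: ts); rewrite /quads big_cons expr0 mulr1 mulrCA mulrC.
  congr (_ * _); rewrite -mul_polyC polyC_natr polyC1 expr1; ring.
by exists b, (t :: ts); rewrite /quads big_cons mulrA polyC1.
Qed.

(** The matrix is the direct sum of an identity and of a cyclic matrix,
    whose characteristic polynomial is still of the class by [recip_poly_cancel]. *)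
Lemma cyclic_mod_fixed_prod rho n (Y : 'M[F]_n) g : rho != 0 -> rho * rho = 1 ->
  cyclic_mod_fixed Y g -> recip_poly (char_poly Y) -> prod_of [:: rho; rho] Y.
Proof.
move=> r0 r2 /cyclic_mod_fixed_split[d [k [C [v [cC sY]]]]].
rewrite (similar_char_poly sY) char_poly_ublock.
have -> : char_poly (1%:M : 'M[F]_k) = ('X - 1) ^+ k.
  rewrite char_poly_trig ?scalar_mx_is_trig //.
  by under eq_bigr => i _ do rewrite mxE eqxx; rewrite prodr_const card_ord.
rewrite mulrC => hr; have {hr} : recip_poly (char_poly C).
  elim: k hr {sY} => [|k IH]; first by rewrite expr0 mul1r.
  by rewrite exprS -mulrA => /recip_poly_cancel/(_ _ erefl).
case/recip_poly_normal=> b [ts eC].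
apply: (prod_of_similar sY); apply: prod_of_diag; last exact: prod_of_1.
apply: realizable_prod cC eC; rewrite -{1}r2; apply: realizable_quads => //.
case: b; last by rewrite expr0; apply: realizable1.
by rewrite expr1; apply: realizable_linear; apply: mem_head.
Qed.

End ModFixed.

(** * Choosing the roots block by block *)
Section BlockInduction.
Variable F : fieldType.

(** The characteristic polynomials allowed for [X]: roots grouped in pairs of
    product [al], apart from the sign [e] and possibly one root 1. *)
Definition paired_poly (al e : F) (q : {poly F}) : Prop :=
  exists b : bool, exists ts,
    q = ('X - e%:P) * ('X - 1%:P) ^+ b * quads al ts.

Lemma quads_cons (al t : F) ts :
  quads al (t :: ts) = ('X^2 - t *: 'X + al%:P) * quads al ts.
Proof. by rewrite /quads big_cons. Qed.

Lemma quad_split (a b t al : F) : t = a + b -> al = a * b ->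
  'X^2 - t *: 'X + al%:P = ('X - a%:P) * ('X - b%:P).
Proof. by move=> -> ->; rewrite -mul_polyC polyCD polyCM; ring. Qed.

Lemma paired_poly_quad (al e a : F) q : a != 0 -> paired_poly al e q ->
  paired_poly al e (('X - (al / a)%:P) * ('X - a%:P) * q).
Proof.
move=> a0 [b [ts ->]]; exists b, ((al / a + a) :: ts).
rewrite quads_cons (@quad_split (al / a) a) ?divfK //.
by rewrite mulrCA.
Qed.

(** A factor x - 1 is multiplied in if there is none yet; otherwise x - al
    is, because (x - 1)(x - al) is one of the quadratic factors. *)
Lemma paired_poly_pad (al e : F) q : al != 0 -> paired_poly al e q -> forall j,
  exists r, [/\ r \is monic, size r = j.+1, r`_0 != 0 & paired_poly al e (r * q)].
Proof.
move=> al0 hq; elim=> [|j [r [mr sr r0 [b [ts hr]]]]].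
  by exists 1; rewrite monic1 size_poly1 coef1 eqxx oner_eq0 mul1r.
(* a = 1 if the optional root 1 is absent, and its partner al if it is present *)
pose a := if b then al else 1.
have a0 : a != 0 by rewrite /a; case: (b); rewrite ?oner_eq0.
exists (r * ('X - a%:P)); split.
- by rewrite monicMl // monicXsubC.
- by rewrite size_Mmonic ?monicXsubC ?monic_neq0 // size_XsubC sr addn2.
- by rewrite coef0M coefB coefX coefC eqxx sub0r mulf_neq0 // oppr_eq0.
rewrite mulrAC hr {hr r0 sr mr}; rewrite /a; case: b {a a0}.
  exists false, ((1 + al) :: ts); rewrite quads_cons.
  rewrite (@quad_split 1 al) ?mul1r // expr0 mulr1 expr1; ring.
by exists true, ts; rewrite expr0 expr1 mulr1; ring.
Qed.

(** The determinant of any matrix with characteristic polynomial [q]. *)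
Definition pdet (q : {poly F}) : F := (-1) ^+ (size q).-1 * q`_0.

Lemma pdet_char n (A : 'M[F]_n) : pdet (char_poly A) = \det A.
Proof.
by rewrite /pdet size_char_poly char_poly_det mulrA -exprMn mulrNN mulr1 expr1n mul1r.
Qed.

Lemma pdetM p q : p != 0 -> q != 0 -> pdet (p * q) = pdet p * pdet q.
Proof.
move=> p0 q0; rewrite /pdet size_mul // coef0M.
have -> : (size p + size q).-2 = ((size p).-1 + (size q).-1)%N.
  have := p0; have := q0; rewrite -!size_poly_gt0.
  by case: (size p) (size q) => [|a] [|b] // _ _; rewrite addnS.
by rewrite exprD mulrACA.
Qed.

Lemma pdet_lin (a : F) : pdet ('X - a%:P) = a.
Proof. by rewrite /pdet size_XsubC coefB coefX coefC sub0r expr1 mulN1r opprK. Qed.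

Lemma size_quad (t al : F) : size ('X^2 - t *: 'X + al%:P : {poly F}) = 3.
Proof.
rewrite -addrA size_polyDl size_polyXn //.
apply: leq_ltn_trans (size_polyD _ _) _; rewrite gtn_max size_polyN.
rewrite (leq_ltn_trans (size_scale_leq _ _)) ?size_polyX //.
by rewrite (leq_ltn_trans (size_polyC_leq1 _)).
Qed.

Lemma quad_neq0 (t al : F) : 'X^2 - t *: 'X + al%:P != 0 :> {poly F}.
Proof. by rewrite -size_poly_gt0 size_quad. Qed.

Lemma pdet_quad (t al : F) : pdet ('X^2 - t *: 'X + al%:P) = al.
Proof.
by rewrite /pdet size_quad !coefD coefN coefZ coefX coefXn coefC /= mulr0 subr0 add0r
  expr2 mulrNN mulr1 mul1r.
Qed.

Lemma quads_facts (al : F) ts :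
  [/\ quads al ts != 0, size (quads al ts) = (size ts).*2.+1 &
  pdet (quads al ts) = al ^+ size ts].
Proof.
elim: ts => [|t ts [n0 sz d]].
  by rewrite /quads big_nil oner_neq0 size_poly1 /pdet size_poly1 coef1 expr0 mulr1.
rewrite quads_cons mulf_neq0 ?quad_neq0 // size_mul ?quad_neq0 // size_quad sz.
by rewrite pdetM ?quad_neq0 // pdet_quad d exprS.
Qed.

Lemma recip_poly_pdet q : recip_poly q -> q != 0 /\ pdet q = 1.
Proof.
case/recip_poly_normal=> b [ts ->]; have [n0 sz d] := quads_facts 1 ts.
case: b; rewrite ?expr1 ?expr0 ?mulr1; last by rewrite d expr1n.
by rewrite mulf_neq0 ?XsubC_neq0 // pdetM ?XsubC_neq0 // pdet_lin d expr1n mulr1.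
Qed.

Lemma paired_poly_facts (al e : F) (b : bool) ts
  (q := ('X - e%:P) * ('X - 1%:P) ^+ b * quads al ts) :
  [/\ q != 0, size q = (b + (size ts).*2).+2 & pdet q = e * al ^+ size ts].
Proof.
have [n0 sz d] := quads_facts al ts; rewrite {}/q.
have l0 : ('X - 1%:P) ^+ b != 0 :> {poly F} by rewrite expf_neq0 ?XsubC_neq0.
have le : ('X - e%:P) * ('X - 1%:P) ^+ b != 0 by rewrite mulf_neq0 ?XsubC_neq0.
split; first by rewrite mulf_neq0.
  rewrite size_mul // sz size_mul ?XsubC_neq0 // size_XsubC.
  by case: b {l0 le}; rewrite ?expr1 ?expr0 ?size_XsubC ?size_poly1 /=; lia.
rewrite pdetM // pdetM ?XsubC_neq0 // pdet_lin d; congr (_ * _).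
by case: b {l0 le}; rewrite ?expr1 ?expr0 ?pdet_lin ?mulr1 // /pdet size_poly1 coef1
  expr0 !mulr1.
Qed.

(** One companion block is processed at a time.  Either all adjustable roots
    of [Y] are paired and the next block of [X] must provide a root [h], or all
    those of [X] are paired and the next block must provide 1 / y as a root of [Y].
    The first case includes the empty matrix, with h = e; for nonempty matrices
    the pending root [x] of [X] is given explicitly as well. *)
Lemma block_induction (al e : F) n (M : 'M[F]_n) : al != 0 -> e != 0 -> M \in unitmx ->
  exists (X Y : 'M[F]_n) (u : 'rV[F]_n),
    [/\ similar_mx M (Y *m X), X \in unitmx, Y \in unitmx, cyclic_vec X u
      & cyclic_mod_fixed Y (u *m invmx X)] /\
    ([/\ recip_poly (char_poly Y),
         exists2 h, h != 0 & paired_poly al e (('X - h%:P) * char_poly X) &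
         (0 < n)%N -> exists x w, x != 0 /\
            char_poly X = ('X - x%:P) * w /\ paired_poly al e w]
     \/ paired_poly al e (char_poly X) /\
        exists y w, [/\ y != 0, recip_poly w & char_poly Y = ('X - y%:P) * w]).
Proof.
move=> al0 e0; elim/ltn_ind: n M => -[_ M _|n IH M uM].
  exists 1%:M, 1%:M, 0; split.
    rewrite mulmx1 unitmx1; split=> //.
    - by rewrite [M](_ : _ = 1%:M); [exact: similar_refl | apply/matrixP=> -[]].
    - by move=> U _ U0 w; rewrite [w]thinmx0 -[0](thinmx0 0).
    - by move=> U _ U0 _ w; rewrite [w]thinmx0 -[X in U X](thinmx0 (0 *m invmx 1%:M)).
  left; rewrite /char_poly !det_mx00; split=> //; first exact: recip_poly1.
  exists e => //; exists false, [::]; rewrite /quads big_nil expr0 !mulr1 //.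
have [m [k [c [M' [mc sc sM]]]]] := cyclic_split M.
have ltkn : (k < n.+1)%N by rewrite (similar_dim sM) addSn ltnS leq_addl.
have [detC0 uM'] : \det (compan_mx m.+1 c) != 0 /\ M' \in unitmx.
  move: uM; rewrite !unitmxE (similar_det sM) det_ublock unitrM unitfE.
  by case/andP.
have c0 : c`_0 != 0.
  by apply: contraNneq detC0 => c0; rewrite det_compan // c0 mulr0.
have [X' [Y' [u' [[sM' uX' uY' cX' cY'] hst]]]] := IH k ltkn M' uM'.
have step p : p \is monic -> size p = m.+2 -> p`_0 != 0 ->
  exists (X Y : 'M_(m.+1 + k)) u,
    [/\ similar_mx M (Y *m X), X \in unitmx, Y \in unitmx, cyclic_vec X u
      & cyclic_mod_fixed Y (u *m invmx X)] /\
    [/\ char_poly X = p * char_poly X' &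
        char_poly Y = ('X - 1) ^+ m * ('X - (c`_0 / p`_0)%:P) * char_poly Y'].
  move=> mp sp p0.
  have [X [Y [u [[eM uX cX cY] hch]]]] := compan_step mc sc mp sp p0 uX' uY' cX' cY'.
  have sM2 : similar_mx M (Y *m X).
    by rewrite -eM; apply: similar_trans sM _;
      apply: similar_block_diag => //; apply: similar_refl.
  exists X, Y, u; split=> //; split=> //.
  by move: uM; rewrite !unitmxE (similar_det sM2) det_mulmx unitrM => /andP[].
have en : n.+1 = (m.+1 + k)%N := similar_dim sM.
rewrite en in M uM sM step *.
case: hst => [[rY [h h0 hcl] _]|[hcl [y [w [y0 rw eY]]]]].
  have [r [mr sr r0 hr]] := paired_poly_pad al0 hcl m.
  have mp : ('X - h%:P) * r \is monic by rewrite monicMl ?monicXsubC.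
  have sp : size (('X - h%:P) * r) = m.+2.
    by rewrite size_mul ?XsubC_neq0 ?monic_neq0 // size_XsubC sr.
  have p0 : (('X - h%:P) * r)`_0 != 0.
    by rewrite coef0M coefB coefX coefC sub0r mulf_neq0 // oppr_eq0.
  have [X [Y [u [hXY [eX eY]]]]] := step _ mp sp p0.
  exists X, Y, u; split=> //; right; split.
    by rewrite eX mulrAC mulrC.
  exists (c`_0 / (('X - h%:P) * r)`_0), (('X - 1) ^+ m * char_poly Y'); split.
  - by rewrite mulf_neq0 // invr_eq0.
  - exact: recip_poly_exp.
  - by rewrite eY mulrAC mulrC.
have [r [mr sr r0 hr]] := paired_poly_pad al0 hcl m.
(* the root x of p must give p(0) = c(0) y, that is, y_1 = 1 / y *)
pose x := - (c`_0 * y / r`_0).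
have x0 : x != 0 by rewrite oppr_eq0 !mulf_neq0 // invr_eq0.
have mp : ('X - x%:P) * r \is monic by rewrite monicMl ?monicXsubC.
have sp : size (('X - x%:P) * r) = m.+2.
  by rewrite size_mul ?XsubC_neq0 ?monic_neq0 // size_XsubC sr.
have ep : (('X - x%:P) * r)`_0 = c`_0 * y.
  by rewrite coef0M coefB coefX coefC sub0r opprK divfK.
have p0 : (('X - x%:P) * r)`_0 != 0 by rewrite ep mulf_neq0.
have [X [Y [u [hXY [eX eY2]]]]] := step _ mp sp p0.
exists X, Y, u; split=> //; left.
have eX2 : char_poly X = ('X - x%:P) * (r * char_poly X') by rewrite eX mulrA.
split; last by move=> _; exists x, (r * char_poly X').
  rewrite eY2 ep eY invfM mulVKf // -mulrA; apply: recip_poly_exp.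
  rewrite mulrA -(@quad_split _ _ _ 1 erefl) ?mulVf //; exact: recip_poly_quad.
(* the pending root is the partner of x *)
exists (al / x); first by rewrite mulf_neq0 // invr_eq0.
by rewrite eX2 mulrA; apply: paired_poly_quad.
Qed.

End BlockInduction.

(** * Products of four matrices *)
Section FourFactors.
Variable F : fieldType.

(** Signs as booleans, so that they can be enumerated and compared even in
    characteristic 2. *)
Definition sign_of (b : bool) : F := if b then -1 else 1.

Lemma sign_of_sqr b : sign_of b * sign_of b = 1.
Proof. by case: b; rewrite /sign_of ?mulrNN mulr1. Qed.

Lemma sign_of_neq0 b : sign_of b != 0.
Proof. by case: b; rewrite /sign_of ?oppr_eq0 oner_neq0. Qed.

Lemma sign_ofM a b : sign_of a * sign_of b = sign_of (a (+) b).
Proof. by case: a; case: b; rewrite /sign_of ?mulN1r ?mulrN1 ?mul1r ?opprK. Qed.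

(** The factor x - e is put in the extra block of [realizable_top_prod].  This
    requires e = rS or e = rS rT, whence the hypothesis. *)
Lemma paired_poly_prod (sS sT sd : bool) n (X : 'M[F]_n) u :
  (sT || ~~ (sS || sd)) -> cyclic_vec X u ->
  paired_poly (sign_of sS * sign_of sT) (sign_of sd) (char_poly X) ->
  prod_of [:: sign_of sS; sign_of sT] X.
Proof.
move=> hs cX [b [ts eX]].
have eps : sign_of sd = sign_of sS * sign_of (sS (+) sd) by rewrite sign_ofM addKb.
apply: (@realizable_top_prod _ _ _ (sign_of (sS (+) sd))
         (quads (sign_of sS * sign_of sT) ts * ('X - 1%:P) ^+ b) _ _ u) => //.
- exact: sign_of_neq0.
- exact: sign_of_neq0.
- by move: hs; case: sS {eX eps}; case: sT; case: sd => //= _;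
    rewrite !inE /sign_of eqxx ?orbT.
- apply: realizable_quads; try exact: sign_of_neq0.
  case: b {eX}; last by rewrite expr0; apply: realizable1.
  by rewrite expr1; apply: realizable_linear; rewrite inE eqxx.
by rewrite -eps eX -mulrA; congr (_ * _); rewrite mulrC.
Qed.

(** The sign [e] is det M * al^((n-1)/2).  If a root [x] of [X] is pending,
    comparing determinants gives x = 1 when there is no factor x - 1 yet and
    x = al otherwise: in both cases it can be absorbed.  If a root [y] of [Y] is
    pending, the same comparison gives y = 1. *)
Lemma prod_of_canonical_four (s sS sT sD : bool) n (M : 'M[F]_n) : (0 < n)%N ->
  \det M = sign_of sD -> (sT || ~~ (sS || sD)) ->
  prod_of [:: sign_of s; sign_of s; sign_of sS; sign_of sT] M.
Proof.
move=> n0 dM hs; pose al := sign_of sS * sign_of sT.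
have al2 : al * al = 1 by rewrite /al sign_ofM sign_of_sqr.
have alE : al = sign_of (sS (+) sT) by rewrite /al sign_ofM.
have powal k : al ^+ k * al ^+ k = 1 by rewrite -exprMn al2 expr1n.
(* the sign e = det M * al^((n-1)/2), as a boolean *)
pose se := sD (+) (odd n.-1./2 && (sS (+) sT)).
have eE : sign_of se = sign_of sD * al ^+ n.-1./2.
  rewrite /se -sign_ofM alE; congr (_ * _).
  case: (_ (+) sT); rewrite ?andbT ?andbF /sign_of ?expr1n //.
  by rewrite -signr_odd; case: odd.
have hse : sT || ~~ (sS || se).
  move: hs; rewrite /se; case: (sT) => //=; case: (sS) => //=.
  by case: (sD) => //=; rewrite andbF.
have uM : M \in unitmx by rewrite unitmxE unitfE dM sign_of_neq0.
have [X [Y [u [[sM uX uY cX cY] hst]]]] :=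
  @block_induction _ al (sign_of se) _ M
    (mulf_neq0 (sign_of_neq0 _) (sign_of_neq0 _)) (sign_of_neq0 _) uM.
have dXY : \det Y * \det X = sign_of sD by rewrite -det_mulmx -(similar_det sM).
suff [rY hX] : recip_poly (char_poly Y) /\ paired_poly al (sign_of se) (char_poly X).
  apply: prod_of_similar sM _; apply/(@prod_of_cat _ [:: _; _]); exists Y, X; split=> //.
    by apply: cyclic_mod_fixed_prod cY rY; [exact: sign_of_neq0 | exact: sign_of_sqr].
  exact: paired_poly_prod hse cX hX.
have sD0 := sign_of_neq0 sD.
case: hst => [[rY _ /(_ n0)[x [w [x0 [eX [b [ts ew]]]]]]]|[hX [y [w [y0 rw eY]]]]].
  split=> //; have [w0 sw dw] := paired_poly_facts al (sign_of se) b ts.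
  have [_ dY] := recip_poly_pdet rY.
  rewrite -ew in w0 sw dw.
  have := congr1 (fun q : {poly F} => size q) eX.
  rewrite size_char_poly size_mul ?XsubC_neq0 // size_XsubC sw => -[en].
  have ex : x = al ^+ (n.-1./2 + size ts).
    have := dXY; rewrite -!pdet_char dY eX pdetM ?XsubC_neq0 // pdet_lin dw mul1r eE.
    move=> h; apply: (mulIf sD0); rewrite -{2}h mulrCA [RHS]mulrCA exprD.
    rewrite -[LHS]mul1r -(powal n.-1./2) -[LHS]mul1r -(powal (size ts)).
    ring.
  case: b ew en {sw} => ew en.
    exists false, ((1 + al) :: ts); rewrite quads_cons (@quad_split _ 1 al) ?mul1r //.
    have -> : char_poly X = ('X - al%:P) * w.
      rewrite eX ex; congr (('X - _%:P) * _).
      have -> : (n.-1./2 + size ts = (size ts).*2.+1)%N by lia.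
      by rewrite exprS -addnn exprD powal mulr1.
    by rewrite ew expr0 expr1; ring.
  exists true, ts.
  have -> : char_poly X = ('X - 1%:P) * w.
    rewrite eX ex; congr (('X - _%:P) * _).
    have -> : (n.-1./2 + size ts = size ts + size ts)%N by lia.
    by rewrite exprD powal.
  by rewrite ew expr0 expr1; ring.
split=> //; case: hX => b [ts eX].
have [_ sX dX] := paired_poly_facts al (sign_of se) b ts.
rewrite -eX in sX dX.
have en : n.-1./2 = size ts.
  by move: sX; rewrite size_char_poly => -[->]; case: (b); rewrite /=; lia.
have [w0 dw] := recip_poly_pdet rw.
have y1 : y = 1.
  have := dXY; rewrite -!pdet_char eY pdetM ?XsubC_neq0 // pdet_lin dw mulr1 dX eE en.
  by rewrite -mulrA powal mulr1 => h; apply: (mulIf sD0); rewrite h mul1r.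
by rewrite eY y1 polyC1; apply: recip_poly_lin.
Qed.

(** Two of the four booleans agree; the equal pair is chosen so that a true
    one, if any, remains, and that one is placed last. *)
Lemma canonical_order (b0 b1 b2 b3 : bool) : exists s sS sT : bool,
  perm_eq [:: s; s; sS; sT] [:: b0; b1; b2; b3] /\
  (sT || ~~ (sS || [|| b0, b1, b2 | b3])).
Proof.
by case: b0; case: b1; case: b2; case: b3;
  first [by exists true, true, true | by exists true, false, true
    | by exists false, true, true | by exists false, false, true
    | by exists false, false, false].
Qed.

Lemma prod_of_four (b0 b1 b2 b3 : bool) n (M : 'M[F]_n) : (0 < n)%N ->
  \det M = 1 \/ (\det M = -1 /\ [|| b0, b1, b2 | b3]) ->
  prod_of [:: sign_of b0; sign_of b1; sign_of b2; sign_of b3] M.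
Proof.
move=> n0 dM; have [s [sS [sT [hp hs]]]] := canonical_order b0 b1 b2 b3.
apply: (@prod_of_perm _ (map sign_of [:: s; s; sS; sT])).
- by rewrite /= !sign_of_neq0.
- exact: perm_map hp.
case: dM => [d1|[dN hb]].
  apply: (@prod_of_canonical_four s sS sT false) => //.
  by move: hs; case: (sT) => //; case: (sS).
apply: (@prod_of_canonical_four s sS sT true) => //.
by move: hs; rewrite hb orbT /= orbF => ->.
Qed.

(** For U2-matrices, write A = 1 + N: det(1 + x N) is a polynomial in x with
    inverse det(1 - x N), hence a constant, equal to its value at x = 0. *)
Lemma quad_mx_det b n (A : 'M[F]_n) : quad_mx (sign_of b) A ->
  \det A = 1 \/ (\det A = -1 /\ b).
Proof.
case: b => /quad_mxE; rewrite /sign_of => hA.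
  have : \det A * \det A = 1.
    rewrite -det_mulmx hA subrr scale0r sub0r -scaleN1r scale_scalar_mx mulrNN mulr1.
    by rewrite det1.
  move/eqP; rewrite -expr2 sqrf_eq1 => /orP[]/eqP->; [left|right] => //.
left.
pose N := A - 1%:M.
have N2 : N *m N = 0 by rewrite -/(quad_mx 1 A); apply/quad_mxE.
pose N' := map_mx polyC N.
have N'2 : N' *m N' = 0 by rewrite -map_mxM N2 map_mx0.
pose p := \det (1%:M + 'X *: N'); pose q := \det (1%:M - 'X *: N').
have pq : p * q = 1.
  rewrite -det_mulmx mulmxBr mulmx1 mulmxDl mul1mx -scalemxAl -scalemxAr N'2 !scaler0.
  by rewrite addr0 addrK det1.
have hev x : p.[x] = \det (1%:M + x *: N).
  rewrite -[LHS]/(horner_eval x p) -det_map_mx; congr (\det _).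
  apply/matrixP=> i j; rewrite !mxE -[LHS]/(_.[x]).
  by case: (i == j); rewrite !hornerE.
have /eqP := congr1 (fun r : {poly F} => size r) pq.
rewrite size_poly1 size_mul_eq1 => /andP[/size_poly1P[c _ pc] _].
have := hev 1; have := hev 0.
rewrite scale0r addr0 det1 scale1r pc !hornerC => -> .
by rewrite addrC subrK.
Qed.

End FourFactors.

Theorem theorem1p5 (F : fieldType) (n : nat) (n_ge1 : (1 <= n)%N)
    (A : 'I_4 -> set 'M[F]_n)
    (hA : forall i : 'I_4, A i = involutions F n \/ A i = U2_matrices F n) :
  ((exists i : 'I_4, A i = involutions F n) ->
     setprod A =
       [set M : 'M[F]_n | GLset F n M /\ (\det M = 1 \/ \det M = -1)]) /\
  (~ (exists i : 'I_4, A i = involutions F n) -> setprod A = SLset F n).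
Proof.
have setE (b : bool) : [set B | quad_mx (sign_of F b) B] =
    if b then involutions F n else U2_matrices F n.
  apply/seteqP; split=> B.
    move=> hB; have uB := quad_mx_unit (sign_of_neq0 F b) hB.
    case: b hB => [/quad_mxE|] hB; split=> //; rewrite expr2 -mulmxE //.
    by rewrite hB /sign_of subrr scale0r sub0r -scaleN1r scale_scalar_mx mulrNN mulr1.
  case: b => -[_]; rewrite expr2 -mulmxE // => hB.
  apply/quad_mxE; rewrite hB /sign_of subrr scale0r sub0r.
  by rewrite -scaleN1r scale_scalar_mx mulrNN mulr1.
have [b hb] : exists b : 'I_4 -> bool,
    (forall i, A i = [set B | quad_mx (sign_of F (b i)) B]) /\
    (forall i, A i = involutions F n <-> b i).
  exists (fun i => `[< A i = involutions F n >]); split=> i; last by split=> /asboolP.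
  by rewrite setE; case: asboolP => // ni; case: (hA i).
have {hb} [Ab Ib] := hb.
pose i0 : 'I_4 := ord0; pose i1 : 'I_4 := lift ord0 ord0.
pose i2 : 'I_4 := lift ord0 (lift ord0 ord0).
pose i3 : 'I_4 := lift ord0 (lift ord0 (lift ord0 ord0)).
have ord4 (P : 'I_4 -> Prop) : P i0 -> P i1 -> P i2 -> P i3 -> forall i, P i.
  move=> p0 p1 p2 p3 i; have : i \in [:: i0; i1; i2; i3].
    by rewrite !inE -!val_eqE; case: i => -[|[|[|[|]]]].
  by rewrite !inE => /or4P[] /eqP->.
have existsE : (exists i, A i = involutions F n) <-> [|| b i0, b i1, b i2 | b i3].
  split=> [[i /Ib]|/or4P[] /Ib]; [|by exists i0|by exists i1|by exists i2|by exists i3].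
  by move: i; apply: ord4 => ->; rewrite ?orbT.
have prodE M : setprod A M <->
    prod_of [:: sign_of F (b i0); sign_of F (b i1); sign_of F (b i2); sign_of F (b i3)] M.
  split=> [[S hS ->]|
    [S0 [? [h0 [S1 [? [h1 [S2 [? [h2 [S3 [? [h3 -> ->]]] ->]]] ->]]] ->]]]].
    have {}hS i : quad_mx (sign_of F (b i)) (S i) by have := hS i; rewrite Ab.
    rewrite !big_ord_recl big_ord0 mulr1.
    exists (S i0), (S i1 * (S i2 * S i3)); split=> //.
    exists (S i1), (S i2 * S i3); split=> //.
    exists (S i2), (S i3); split=> //.
    by exists (S i3), 1%:M; rewrite mulmx1.
  exists (fun i => nth 1 [:: S0; S1; S2; S3] i).
    by apply: ord4; rewrite Ab.
  by rewrite !big_ord_recl big_ord0 mulr1 mulmx1.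
have detE M : setprod A M ->
    \det M = 1 \/ (\det M = -1 /\ [|| b i0, b i1, b i2 | b i3]).
  case=> S hS ->; rewrite !big_ord_recl big_ord0 mulr1 -!mulmxE !det_mulmx.
  have {}hS i : \det (S i) = 1 \/ (\det (S i) = -1 /\ b i).
    by apply: quad_mx_det; have := hS i; rewrite Ab.
  have mulE (x y : F) (c d : bool) : x = 1 \/ (x = -1 /\ c) ->
      y = 1 \/ (y = -1 /\ d) -> x * y = 1 \/ (x * y = -1 /\ c || d).
    move=> [->|[-> ->]] [->|[-> ->]]; rewrite ?mul1r ?mulr1 ?mulrNN ?mulr1 ?orbT;
      first [by left | by right].
  by do 3![apply: (mulE); first exact: hS].
split=> [/existsE hb|/existsE/negP hb]; apply/seteqP; split=> M.
- move=> hM; have [d1|[dN _]] := detE _ hM; split;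
    rewrite /GLset /= ?unitmxE ?d1 ?dN ?unitrN ?unitr1 //.
  + by left.
  + by right.
- case=> _ hd; apply/prodE/prod_of_four => //.
  by case: hd => hd; [left | right].
- by move=> hM; have [//|[_ h]] := detE _ hM; case/negP: hb.
by move=> hM; apply/prodE/prod_of_four => //; left.
Qed.
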